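(* One has $P_B^\perp=\Psi_B^{-1}(Q_v^\perp)$ and $\dim_{\mathbb C}(P_B^\perp)\le\dim_{\mathbb C}(Q_v^\perp)$. Furthermore, if $B$ is a basis of $L$, then $\Psi_B(P_B^\perp)=Q_v^\perp$ and $\dim_{\mathbb C}(Q_v^\perp)=\dim_{\mathbb C}(P_B^\perp)$.
   Context: $\mathbb N=\{0,1,2,\dots\}$. $A$ is a $d\times n$ integer matrix of rank $d$ which is homogeneous: all its columns lie on one hyperplane of $\mathbb Q^d$ not passing through the origin. $L=\{u\in\mathbb Z^n: Au=0\}$. Each $u\in\mathbb Z^n$ is written uniquely as $u=u_+-u_-$ with $u_\pm\in\mathbb N^n$ of disjoint supports. $I_A=\langle\partial^u-\partial^{u'}: u,u'\in\mathbb N^n, Au=Au'\rangle\subset\mathbb C[\partial_1,\dots,\partial_n]$. For $v\in\mathbb C^n$, $u\in\mathbb N^n$: $[v]_u=\prod_j v_j(v_j-1)\cdots(v_j-u_j+1)$; $\mathrm{nsupp}(v)=\{j: v_j\in\mathbb Z_{<0}\}$. Fix $\beta\in\mathbb C^d$, a generic weight $w\in\mathbb R^n$ (in particular $\mathrm{in}_w(I_A)$ is monomial) and a fake exponent $v$ of the $A$-hypergeometric ideal $H_A(\beta)$ with respect to $w$, i.e. $Av=\beta$ and $[v]_{u_+}=0$ for all $u\in L$ with $u_+\cdot w>u_-\cdot w$. Write $I_u=\mathrm{nsupp}(v+u)$ for $u\in L$. Let $B=\{b^{(1)},\dots,b^{(h)}\}\subset L$ be linearly independent, also regarded as the $n\times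 h$ matrix with these columns; $\mathrm{supp}(B)$ is the set of indices of its nonzero rows. Assume $I_0\subset\mathrm{supp}(B)\cup I_u$ for all $u\in L$. $s=(s_1,\dots,s_h)^T$ are indeterminates, $(Bs)_j=\sum_k b_j^{(k)}s_k$, $(Bs)^J=\prod_{j\in J}(Bs)_j$. Let $\{\partial^{g_+^{(i)}}-\partial^{g_-^{(i)}}: i=1,\dots,M\}$ be the reduced Gröbner basis of $I_A$ with respect to $w$, $\partial^{g_+^{(i)}}\in\mathrm{in}_w(I_A)$, and $G^{(i)}=I_{-g^{(i)}}\setminus I_0=\{j: v_j\in\mathbb N,\ g^{(i)}_j-v_j>0\}$. Define $Q_v=\langle A\theta_x\rangle+\langle\prod_{j\in G^{(i)}}\theta_j: i=1,\dots,M\rangle\subset\mathbb C[\theta_1,\dots,\theta_n]$, where $\langle A\theta_x\rangle$ is generated by the linear forms $\sum_ja_{kj}\theta_j$; $Q_v^\perp=\{f\in\mathbb C[x_1,\dots,x_n]:\phi(\partial_x)\bullet f=0\text{ for all }\phi(\theta_x)\in Q_v\}$, where $\phi(\partial_x)$ is obtained by substituting $\theta_j\mapsto\partial_j$; $P_B=\langle(Bs)^{G^{(i)}}:i=1,\dots,M\rangle\subset\mathbb C[s]$; for a homogeneous ideal $P\subset\mathbb C[s]$, $P^\perp=\{q(\partial_s)\in\mathbb C[\partial_s]:(q(\partial_s)\bullet h(s))_{|s=0}=0\ \forall h\in P\}$, with $\mathbb C[\partial_s]=\mathbb C[\partial_{s_1},\dots,\partial_{s_h}]$. $\Psi_B:\mathbb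 C[\partial_s]\to\mathbb C[x]$ is the ring homomorphism $\Psi_B(q(\partial_s))(x)=q\bigl(\sum_jb_j^{(1)}x_j,\dots,\sum_jb_j^{(h)}x_j\bigr)$ (injective, since $B$ is linearly independent). *)

(* Defs.v *)
From mathcomp Require Import all_boot all_order all_algebra.
From mathcomp Require Import all_classical reals.
From mathcomp Require Import complex mpoly constructive_ereal.

Set Implicit Arguments.
Unset Strict Implicit.
Unset Printing Implicit Defensive.

Import Order.TTheory GRing.Theory Num.Theory.

Local Open Scope classical_set_scope.
Local Open Scope ring_scope.

(* The field of complex numbers is R[i] for R : realType.  All the polynomial
   rings C[d_1..d_n], C[theta], C[x] (resp. C[s], C[d_s]) are represented by
   the same type {mpoly R[i][n]} (resp. {mpoly R[i][h]}). *)

Section Ideals.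
Context {K : comNzRingType} {n : nat}.
Implicit Types (S I J : set {mpoly K[n]}).

Definition ideal_gen S : set {mpoly K[n]} :=
  [set p | exists (k : nat) (a s : 'I_k -> {mpoly K[n]}),
     (forall i, S (s i)) /\ p = \sum_(i < k) a i * s i].

Definition ideal_add I J : set {mpoly K[n]} :=
  [set p + q | p in I & q in J].

Definition monomial_ideal I : Prop :=
  exists S : set 'X_{1..n}, I = ideal_gen [set 'X_[m] | m in S].

End Ideals.

Section Dimension.
Context {K : fieldType} {E : lmodType K}.

Definition has_basis (V : set E) (k : nat) : Prop :=
  exists b : 'I_k -> E,
    (forall a : 'I_k -> K, \sum_i a i *: b i = 0 -> forall i, a i = 0) /\
    V = [set f | exists a : 'I_k -> K, f = \sum_i a i *: b i].

(* Dimension of a subspace, +oo when there is no finite basis.  The number k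
   chosen below is unique.  On spaces of polynomials, which have countable
   dimension, this loses no information on the cardinality of a basis. *)
Definition subspace_dim (R : realType) (V : set E) : \bar R :=
  if pselect (exists k, has_basis V k) is left ex_k
  then (projT1 (cid ex_k))%:R%:E else +oo%E.

End Dimension.

Definition ratmx m n (A : 'M[int]_(m, n)) : 'M[rat]_(m, n) := map_mx intr A.

Definition cplxmx (R : realType) m n (A : 'M[int]_(m, n)) : 'M[R[i]]_(m, n) :=
  map_mx intr A.
Arguments cplxmx R {m n} A.

Definition homogeneous_mx d n (A : 'M[int]_(d, n)) : Prop :=
  exists (c : 'rV[rat]_d) (k : rat),
    [/\ c != 0, k != 0 & forall j, (c *m col j (ratmx A)) 0 0 = k].

Definition kerL d n (A : 'M[int]_(d, n)) : set 'cV[int]_n :=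
  [set u | A *m u = 0].

Definition pos_part n (u : 'cV[int]_n) : 'X_{1..n} :=
  [multinom absz (Num.max (u j 0) 0)%R | j < n].

Definition neg_part n (u : 'cV[int]_n) : 'X_{1..n} := pos_part (- u).

Definition mnm_col n (m : 'X_{1..n}) : 'cV[int]_n := \col_j (m j)%:Z.

Section Hypergeometric.
Context {R : realType}.
Local Notation C := R[i].

Definition toric_ideal d n (A : 'M[int]_(d, n)) : set {mpoly C[n]} :=
  ideal_gen [set p | exists u u' : 'X_{1..n},
    A *m mnm_col u = A *m mnm_col u' /\ p = 'X_[u] - 'X_[u']].

Definition wdot n (w : 'cV[R]_n) (m : 'X_{1..n}) : R :=
  \sum_j w j 0 * (m j)%:R.

Definition init_form n (w : 'cV[R]_n) (f : {mpoly C[n]}) : {mpoly C[n]} :=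
  \sum_(m <- msupp f | all (fun m' => wdot w m' <= wdot w m) (msupp f))
    f@_m *: 'X_[m].

Definition init_ideal n (w : 'cV[R]_n) (I : set {mpoly C[n]}) :
    set {mpoly C[n]} :=
  ideal_gen [set init_form w f | f in I].

(* The second-to-last clause says that leading terms are monomials with
   coefficient 1. *)
Definition reduced_groebner_basis n (w : 'cV[R]_n)
    (I G : set {mpoly C[n]}) : Prop :=
  [/\ finite_set G,
      G `<=` I,
      init_ideal w I = ideal_gen [set init_form w g | g in G],
      (forall g, G g -> exists m, init_form w g = 'X_[m]) &
      (forall g g' m m', G g -> G g' -> g <> g' ->
         init_form w g = 'X_[m] -> m' \in msupp g' -> ~~ (m <= m')%MM)].

Definition falling n (v : 'cV[C]_n) (u : 'X_{1..n}) : C :=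
  \prod_j \prod_(k < u j) (v j 0 - k%:R).

Definition nsupp n (v : 'cV[C]_n) : {set 'I_n} :=
  [set j | `[< exists2 z : int, z < 0 & v j 0 = z%:~R >]]%SET.

Definition fake_exponent d n (A : 'M[int]_(d, n)) (beta : 'cV[C]_d)
    (w : 'cV[R]_n) (v : 'cV[C]_n) : Prop :=
  cplxmx R A *m v = beta /\
  forall u, kerL A u -> wdot w (neg_part u) < wdot w (pos_part u) ->
    falling v (pos_part u) = 0.

Definition Gset n (v : 'cV[C]_n) (g : 'cV[int]_n) : {set 'I_n} :=
  nsupp (v - cplxmx R g) :\: nsupp v.

(* phi(d_x) applied to f *)
Definition diffop n (phi f : {mpoly C[n]}) : {mpoly C[n]} :=
  \sum_(m <- msupp phi) phi@_m *: f^`M[m].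

Section Q.
Context {d n M : nat}.
Variables (A : 'M[int]_(d, n)) (v : 'cV[C]_n) (g : 'I_M -> 'cV[int]_n).

Definition Q_ideal : set {mpoly C[n]} :=
  ideal_add
    (ideal_gen [set \sum_j (A k j)%:~R *: 'X_j | k in [set: 'I_d]])
    (ideal_gen [set \prod_(j in Gset v (g i)) 'X_j | i in [set: 'I_M]]).

Definition Q_perp : set {mpoly C[n]} :=
  [set f | forall phi, Q_ideal phi -> diffop phi f = 0].

End Q.

Section P.
Context {n h : nat}.
Variable B : 'M[int]_(n, h).

Definition supp_rows : {set 'I_n} := [set j | row j B != 0]%SET.

Definition Bs (j : 'I_n) : {mpoly C[h]} := \sum_k (B j k)%:~R *: 'X_k.

Definition P_ideal M (v : 'cV[C]_n) (g : 'I_M -> 'cV[int]_n) :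
    set {mpoly C[h]} :=
  ideal_gen [set \prod_(j in Gset v (g i)) Bs j | i in [set: 'I_M]].

Definition perp (P : set {mpoly C[h]}) : set {mpoly C[h]} :=
  [set q | forall p, P p -> (diffop q p).@[fun=> 0] = 0].

Definition Psi (q : {mpoly C[h]}) : {mpoly C[n]} :=
  q \mPo [tuple \sum_j (B j k)%:~R *: 'X_j | k < h].

End P.

End Hypergeometric.

(* Main.v *)
(* Psi_B substitutes x |-> B^T x, so by the chain rule phi(d_x) applied to
   Psi_B q equals Psi_B applied to phi(B d_s) q. The substitution
   theta |-> B s kills the forms A theta and sends prod_(j in G) theta_j to
   (Bs)^G, so by injectivity of Psi_B, q lies in Psi_B^-1(Q_v^perp) iff every
   generator of P_B, as a differential operator, annihilates q. By symmetry of
   the pairing (q, p) |-> (q(d) p)(0), this says that q is in P_B^perp.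

   If B generates L, take a rational D with D^T B = 1; then
   B D^T = 1 - E A for some E. An f annihilated by A d_x satisfies
   f(D B^T x) = f(x), because both sides have the same derivatives at 0;
   hence f = Psi_B (f o D). *)

From HB Require Import structures.
Require Import Defs.
From mathcomp Require Import all_boot all_order all_algebra.
From mathcomp Require Import all_classical reals.
From mathcomp Require Import complex mpoly constructive_ereal.
From mathcomp Require Import ssrcomplements.
Import Order.TTheory GRing.Theory Num.Theory.
Local Open Scope classical_set_scope.
Local Open Scope ring_scope.

(** * Induction over polynomials and evaluation at the origin *)

Section PolynomialRing.
Context (K : comNzRingType) (n : nat).
Implicit Types p q : {mpoly K[n]}.

(** Every monomial is a product of variables, so identities compatible with sums and products need
    checking only on constants and variables. *)
Lemma mpoly_ring_ind (P : {mpoly K[n]} -> Prop) :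
  (forall c, P c%:MP) -> (forall i, P 'X_i) ->
  (forall p q, P p -> P q -> P (p + q)) ->
  (forall p q, P p -> P q -> P (p * q)) -> forall p, P p.
Proof.
move=> PC PX PD PM; elim/mpolyind; first by rewrite -mpolyC0.
move=> c m p _ _ Pp; apply: PD => //; rewrite -mul_mpolyC; apply: (PM) => //.
rewrite mpolyXE_id; apply: (big_ind P) => [|//|i _]; first by rewrite -mpolyC1.
elim: (m i) => [|k Pk]; first by rewrite expr0 -mpolyC1.
by rewrite exprS; apply: PM.
Qed.

Lemma meval_at0 p : p.@[fun=> 0] = p@_0%MM.
Proof.
elim/mpoly_ring_ind: p => [c|i|p q|p q].
- by rewrite mevalC mcoeffC eqxx mulr1.
- by rewrite mevalXU mcoeffX; case: eqP => // /mnmP/(_ i); rewrite mnm1E eqxx mnm0E.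
- by rewrite mevalD mcoeffD => -> ->.
- by rewrite mevalM rmorphM /= => -> ->.
Qed.

Lemma mderivXU (i j : 'I_n) : ('X_i : {mpoly K[n]})^`M(j) = (i == j)%:R%:MP.
Proof.
rewrite mderivX mnm1E; case: eqP => [->|_]; last by rewrite scale0r.
by rewrite -{1}[U_(j)%MM]add0m addmK mpolyX0 scale1r.
Qed.

End PolynomialRing.

(** * Linear substitutions and the chain rule *)

Section LinearSubstitution.
Context {K : comNzRingType}.

(** The substitution q |-> q(N^T x): [Psi] with arbitrary coefficients, so that one-sided inverses
    of [B], which may have non-integral entries, are covered too. *)
Definition lin_subst {n h} (N : 'M[K]_(n, h)) (q : {mpoly K[h]}) : {mpoly K[n]} :=
  q \mPo [tuple \sum_j N j k *: 'X_j | k < h].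

HB.instance Definition _ n h (N : 'M[K]_(n, h)) :=
  GRing.RMorphism.copy (lin_subst N) (comp_mpoly [tuple \sum_j N j k *: 'X_j | k < h]).
HB.instance Definition _ n h (N : 'M[K]_(n, h)) :=
  GRing.Linear.copy (lin_subst N) (comp_mpoly [tuple \sum_j N j k *: 'X_j | k < h]).

Lemma lin_substC n h (N : 'M[K]_(n, h)) c : lin_subst N c%:MP = c%:MP.
Proof. exact: comp_mpolyC. Qed.

Lemma lin_substX n h (N : 'M[K]_(n, h)) k :
  lin_subst N 'X_k = \sum_j N j k *: 'X_j.
Proof. by rewrite /lin_subst comp_mpolyXU -tnth_nth tnth_mktuple. Qed.

Lemma lin_subst_mul n h l (N : 'M[K]_(n, h)) (N' : 'M[K]_(h, l)) q :
  lin_subst N (lin_subst N' q) = lin_subst (N *m N') q.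
Proof.
elim/mpoly_ring_ind: q => [c|i|p q|p q].
- by rewrite !lin_substC.
- rewrite !lin_substX raddf_sum /=.
  under eq_bigr do rewrite linearZ /= lin_substX scaler_sumr.
  rewrite exchange_big; apply: eq_bigr => j _.
  by rewrite mxE scaler_suml; apply: eq_bigr => k _; rewrite scalerA mulrC.
- by rewrite !raddfD /= => -> ->.
- by rewrite !rmorphM /= => -> ->.
Qed.

Lemma lin_subst1 n (q : {mpoly K[n]}) : lin_subst 1%:M q = q.
Proof.
rewrite /lin_subst -[RHS](comp_mpoly_id q); congr (_ \mPo _).
apply: eq_from_tnth => k; rewrite !tnth_mktuple (bigD1 k) //= mxE eqxx scale1r.
by rewrite big1 ?addr0 // => j /negPf nk; rewrite mxE nk scale0r.
Qed.

Lemma lin_subst_at0 n h (N : 'M[K]_(n, h)) q :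
  (lin_subst N q).@[fun=> 0] = q.@[fun=> 0].
Proof.
rewrite comp_mpoly_meval; apply: meval_eq => k.
rewrite tnth_mktuple raddf_sum big1 // => j _.
by rewrite /= mevalZ mevalXU mulr0.
Qed.

Lemma mderiv_lin_subst n h (N : 'M[K]_(n, h)) q j :
  (lin_subst N q)^`M(j) = \sum_k N j k *: lin_subst N (q^`M(k)).
Proof.
elim/mpoly_ring_ind: q => [c|i|p q Hp Hq|p q Hp Hq].
- rewrite lin_substC mderivC big1 // => k _.
  by rewrite mderivC raddf0 scaler0.
- rewrite lin_substX raddf_sum (bigD1 j) //= [RHS](bigD1 i) //=.
  rewrite linearZ /= !mderivXU !eqxx !lin_substC.
  rewrite !big1 // => k /negPf nk.
    by rewrite mderivXU eq_sym nk lin_substC mpolyC0 scaler0.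
  by rewrite linearZ /= mderivXU nk mpolyC0 scaler0.
- rewrite raddfD /= mderivD Hp Hq -big_split; apply: eq_bigr => k _.
  by rewrite mderivD raddfD scalerDr.
- rewrite rmorphM /= mderivM Hp Hq mulr_suml mulr_sumr -big_split.
  apply: eq_bigr => k _; rewrite mderivM raddfD /= !rmorphM /= scalerDr.
  by rewrite scalerAl scalerAr.
Qed.

End LinearSubstitution.

(** * Constant-coefficient differential operators and the pairing at the origin *)

Section Diffop.
Context {R : realType}.
Local Notation C := R[i].

(** Replaces the support of [phi] by an index set shared by several operators, so that their sums
    can be compared term by term. *)
Lemma diffopwE n k (phi f : {mpoly C[n]}) : (msize phi <= k)%N ->
  diffop phi f = \sum_(m : 'X_{1..n < k}) phi@_m *: f^`M[m].
Proof.
move=> lek; rewrite /diffop (big_mksub 'X_{1..n < k}) ?msupp_uniq //=.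
  by rewrite big_rmcond //= => m /memN_msupp_eq0 ->; rewrite scale0r.
by move=> m /msize_mdeg_lt /leq_trans; apply.
Qed.

Lemma diffop_is_linear n (phi : {mpoly C[n]}) : linear (diffop phi).
Proof.
move=> a f g; rewrite /diffop scaler_sumr -big_split; apply: eq_bigr => m _.
by rewrite linearP scalerDr !scalerA mulrC.
Qed.
HB.instance Definition _ n (phi : {mpoly C[n]}) :=
  GRing.isLinear.Build C {mpoly C[n]} {mpoly C[n]} _ (diffop phi)
    (diffop_is_linear n phi).

Lemma diffopD n (phi psi f : {mpoly C[n]}) :
  diffop (phi + psi) f = diffop phi f + diffop psi f.
Proof.
pose k := maxn (msize (phi + psi)) (maxn (msize phi) (msize psi)).
rewrite !(diffopwE n k) ?leq_max ?leqnn ?orbT // -big_split.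
by apply: eq_bigr => m _; rewrite mcoeffD scalerDl.
Qed.

Lemma diffopZ n a (phi f : {mpoly C[n]}) :
  diffop (a *: phi) f = a *: diffop phi f.
Proof.
pose k := maxn (msize (a *: phi)) (msize phi).
rewrite !(diffopwE n k) ?leq_max ?leqnn ?orbT // scaler_sumr.
by apply: eq_bigr => m _; rewrite mcoeffZ scalerA.
Qed.

Lemma diffop0 n (f : {mpoly C[n]}) : diffop 0 f = 0.
Proof. by rewrite -(scale0r 0) diffopZ !scale0r. Qed.

Lemma diffop_sum n (I : Type) (r : seq I) (P : pred I)
    (F : I -> {mpoly C[n]}) f :
  diffop (\sum_(i <- r | P i) F i) f = \sum_(i <- r | P i) diffop (F i) f.
Proof.
elim/big_rec2: _ => [|i p q _ <-]; first exact: diffop0.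
by rewrite diffopD.
Qed.

Lemma diffopXm n m (f : {mpoly C[n]}) : diffop 'X_[m] f = f^`M[m].
Proof. by rewrite /diffop msuppX big_seq1 mcoeffX eqxx scale1r. Qed.

Lemma diffopX n j (f : {mpoly C[n]}) : diffop 'X_j f = f^`M(j).
Proof. by rewrite diffopXm mderivmU1m. Qed.

Lemma diffopC n c (f : {mpoly C[n]}) : diffop c%:MP f = c *: f.
Proof. by rewrite -[c%:MP]mulr1 mul_mpolyC diffopZ -mpolyX0 diffopXm mderivm0m. Qed.

Lemma diffopM n (phi psi f : {mpoly C[n]}) :
  diffop (phi * psi) f = diffop phi (diffop psi f).
Proof.
rewrite {1}[phi]mpolyE mulr_suml diffop_sum; apply: eq_bigr => m _.
rewrite -scalerAl diffopZ; congr (_ *: _).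
rewrite {1}[psi]mpolyE mulr_sumr diffop_sum raddf_sum; apply: eq_bigr => m' _.
by rewrite -scalerAr diffopZ -mpolyXD diffopXm addmC mderivmDm /= mderivmZ.
Qed.

Lemma diffop_comm n (phi psi f : {mpoly C[n]}) :
  diffop phi (diffop psi f) = diffop psi (diffop phi f).
Proof. by rewrite -!diffopM mulrC. Qed.

(** Both sides equal the sum over m of m! p_m q_m, which is symmetric. *)
Lemma diffop_at0C n (p q : {mpoly C[n]}) :
  (diffop p q).@[fun=> 0] = (diffop q p).@[fun=> 0].
Proof.
rewrite !meval_at0; pose k := maxn (msize p) (msize q).
rewrite !(diffopwE n k) ?leq_max ?leqnn ?orbT // !raddf_sum.
apply: eq_bigr => m _; rewrite /= !mcoeffZ !mcoeff_mderivm !addm0.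
by rewrite !mulrnAr mulrC.
Qed.

(** The operator of the monomial m reads off m! times the coefficient at m, and m! is invertible in
    characteristic 0. *)
Lemma diffop_at0_inj n (f g : {mpoly C[n]}) :
  (forall phi, (diffop phi f).@[fun=> 0] = (diffop phi g).@[fun=> 0]) -> f = g.
Proof.
move=> fg; apply/mpolyP => m; have := fg 'X_[m].
rewrite !meval_at0 !diffopXm !mcoeff_mderivm !addm0 -mulr_natr -[RHS]mulr_natr.
apply: mulIf; rewrite pnatr_eq0 -lt0n prodn_gt0 // => i.
by rewrite ffactnn fact_gt0.
Qed.

(** The chain rule gives the case of one derivative; composition of operators extends it to all of
    them. The transpose appears because operators transform contragrediently to points. *)
Lemma diffop_lin_subst n h (N : 'M[C]_(n, h)) phi q :
  diffop phi (lin_subst N q) = lin_subst N (diffop (lin_subst N^T phi) q).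
Proof.
elim/mpoly_ring_ind: phi q => [c|j|p p' Hp Hp'|p p' Hp Hp'] q.
- by rewrite lin_substC !diffopC linearZ.
- rewrite diffopX mderiv_lin_subst lin_substX diffop_sum raddf_sum.
  by apply: eq_bigr => k _; rewrite /= diffopZ linearZ /= diffopX mxE.
- by rewrite raddfD /= !diffopD raddfD Hp Hp'.
- by rewrite rmorphM /= !diffopM Hp' Hp.
Qed.

Lemma diffop_ideal_gen n (S : set {mpoly C[n]}) f :
  (forall p, ideal_gen S p -> diffop p f = 0) <->
  (forall p, S p -> diffop p f = 0).
Proof.
split=> Sf p.
  move=> Sp; apply: Sf; exists 1%N, (fun=> 1), (fun=> p); split=> //.
  by rewrite big_ord1 mul1r.
move=> [k [a [s [Ss ->]]]]; rewrite diffop_sum big1 // => i _.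
by rewrite diffopM Sf // raddf0.
Qed.

(** Vanishing at 0 upgrades to vanishing identically: for p in the ideal, phi p is in it for every
    phi, so all derivatives of p(d) q vanish at 0. *)
Lemma perp_ideal_genE h (S : set {mpoly C[h]}) q :
  perp (ideal_gen S) q <-> (forall p, S p -> diffop p q = 0).
Proof.
rewrite -diffop_ideal_gen; split=> Sq p Sp; last first.
  by rewrite diffop_at0C Sq // meval0.
apply: diffop_at0_inj => phi; rewrite raddf0 -diffopM diffop_at0C Sq ?meval0 //.
case: Sp => k [a [s [Ss ->]]]; exists k, (fun i => phi * a i), s; split=> //.
by rewrite mulr_sumr; apply: eq_bigr => i _; rewrite mulrA.
Qed.

Lemma Q_perpE d n M (A : 'M[int]_(d, n)) v (g : 'I_M -> 'cV[int]_n)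
    (f : {mpoly C[n]}) :
  Q_perp A v g f <->
    (forall k, diffop (\sum_j (A k j)%:~R *: 'X_j) f = 0) /\
    (forall i, diffop (\prod_(j in Gset v (g i)) 'X_j) f = 0).
Proof.
(* The empty combination; it lets each summand embed into the sum of the two ideals. *)
have gen0 (S : set {mpoly C[n]}) : ideal_gen S 0.
  by exists 0%N, (fun=> 0), (fun=> 0); rewrite big_ord0; split=> // -[].
split=> [Qf|[Af Gf] _ [p Ap [q Gq <-]]].
  split.
    suff Af p : [set \sum_j (A k j)%:~R *: 'X_j | k in [set: 'I_d]] p ->
        diffop p f = 0 by move=> k; apply: Af; exists k.
    move: p; apply/diffop_ideal_gen => p Sp.
    by apply: Qf; exists p => //; exists 0; rewrite ?addr0.
  suff Gf p : [set \prod_(j in Gset v (g i)) 'X_j | i in [set: 'I_M]] p ->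
      diffop p f = 0 by move=> i; apply: Gf; exists i.
  move: p; apply/diffop_ideal_gen => p Sp.
  by apply: Qf; exists 0 => //; exists p; rewrite ?add0r.
rewrite diffopD.
rewrite (iffRL (diffop_ideal_gen _ _ f) _ p Ap) => [|_ [k _ <-]]; last exact: Af.
rewrite (iffRL (diffop_ideal_gen _ _ f) _ q Gq) ?addr0 // => _ [i _ <-].
exact: Gf.
Qed.

(** The transposed substitution fixes each variable modulo the linear forms given by the rows of
    [a], and these annihilate f. Hence f and its substitute have the same derivatives at 0. *)
Lemma lin_subst_invariant d n (a : 'M[C]_(d, n)) (e : 'M[C]_(n, d))
    (N : 'M[C]_n) (f : {mpoly C[n]}) :
  N = 1%:M - e *m a ->
  (forall k, diffop (\sum_j a k j *: 'X_j) f = 0) ->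
  lin_subst N f = f.
Proof.
move=> NE af.
have Nf phi : diffop (lin_subst N^T phi) f = diffop phi f.
  elim/mpoly_ring_ind: phi f af => [c|j|p q Hp Hq|p q Hp Hq] f af.
  - by rewrite lin_substC.
  - rewrite lin_substX.
    have -> : \sum_k N^T k j *: 'X_k
        = 'X_j - \sum_i e j i *: (\sum_k a i k *: 'X_k) :> {mpoly C[n]}.
      rewrite NE; under eq_bigr do rewrite !mxE scalerBl.
      rewrite sumrB (bigD1 j) //= eqxx scale1r big1 ?addr0; last first.
        by move=> k /negPf nk; rewrite eq_sym nk scale0r.
      congr (_ - _); under [RHS]eq_bigr do rewrite scaler_sumr.
      rewrite exchange_big; apply: eq_bigr => k _.
      by rewrite scaler_suml; apply: eq_bigr => i _; rewrite scalerA.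
    rewrite -scaleN1r diffopD diffopZ diffop_sum big1 ?scaler0 ?addr0 // => i _.
    by rewrite diffopZ af scaler0.
  - rewrite (raddfD (lin_subst N^T)) !diffopD.
    by congr (_ + _); [exact: Hp|exact: Hq].
  - rewrite (rmorphM (lin_subst N^T)) !diffopM.
    (* The hypothesis for p is applied to q(d) f in place of f; it qualifies because the linear
       forms commute with q(d). *)
    apply: (etrans (congr1 _ (Hq f af))); apply: Hp => k.
    by rewrite diffop_comm af raddf0.
apply: diffop_at0_inj => phi; rewrite diffop_lin_subst lin_subst_at0.
exact: (congr1 _ (Nf phi)).
Qed.

End Diffop.

(** * Comparing dimensions along maps injective on a subspace *)

Section Dimension.
Context {K : fieldType}.

(** The coordinates of the images [phi (b i)] in a basis of W form an m by k matrix; a row vector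
    killing it is a relation among the [b i], so its rows are independent and m is at most k. *)
Lemma free_family_bound (E F : lmodType K) (phi : {linear E -> F})
    (V : set E) (W : set F) k m (b : 'I_m -> E) :
  (forall (a : 'I_m -> K), V (\sum_i a i *: b i)) ->
  (forall x, V x -> phi x = 0 -> x = 0) -> (forall x, V x -> W (phi x)) ->
  has_basis W k ->
  (forall a : 'I_m -> K, \sum_i a i *: b i = 0 -> forall i, a i = 0) ->
  (m <= k)%N.
Proof.
move=> Vb phi_inj phiW [c [_ Wc]] b_free.
have Vbi i : V (b i).
  (* Kronecker coefficients single out [b i]. *)
  have := Vb (fun j => (j == i)%:R); rewrite (bigD1 i) //= eqxx scale1r.
  by rewrite big1 ?addr0 // => j /negPf ->; rewrite scale0r.
have /choice [x xP] i : exists a : 'I_k -> K, phi (b i) = \sum_j a j *: c j.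
  by have := phiW _ (Vbi i); rewrite Wc.
pose X := \matrix_(i < m, j < k) x i j.
suff /eqP <- : row_free X by exact: rank_leq_col.
apply: inj_row_free => a aX; apply/rowP => i; rewrite mxE.
apply: (b_free (fun i => a 0 i)); apply: phi_inj => //.
rewrite raddf_sum; under eq_bigr do rewrite /= linearZ /= xP scaler_sumr.
rewrite exchange_big big1 // => j _ /=; under eq_bigr do rewrite scalerA.
rewrite -scaler_suml; move/rowP/(_ j): aX; rewrite !mxE => aXj.
by under eq_bigr do rewrite -[x _ _](mxE matrix_key); rewrite aXj scale0r.
Qed.

(* A maximal independent family of V exists since their sizes are bounded by k. *)
Lemma sub_has_basis (E F : lmodType K) (phi : {linear E -> F})
    (V : set E) (W : set F) k :
  V 0 -> (forall a x y, V x -> V y -> V (a *: x + y)) ->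
  (forall x, V x -> phi x = 0 -> x = 0) -> (forall x, V x -> W (phi x)) ->
  has_basis W k -> exists2 m, (m <= k)%N & has_basis V m.
Proof.
move=> V0 VL phi_inj phiW Wk.
have Vsum m (b : 'I_m -> E) : (forall i, V (b i)) ->
    forall a : 'I_m -> K, V (\sum_i a i *: b i).
  move=> Vb a; apply: (big_ind V) => // [x y Vx Vy|i _].
    by rewrite -[x]scale1r; apply: VL.
  by rewrite -[_ *: _]addr0; apply: VL.
pose P m := `[< exists b : 'I_m -> E, (forall i, V (b i)) /\
  forall a : 'I_m -> K, \sum_i a i *: b i = 0 -> forall i, a i = 0 >].
have P0 : exists m, P m.
  by exists 0%N; apply/asboolP; exists (fun=> 0); split=> [[]|? _ []].
have Pk m : P m -> (m <= k)%N.
  move=> /asboolP [b [Vb b_free]].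
  exact: (free_family_bound E F phi V W k m b (Vsum m b Vb)).
case: (ex_maxnP P0 Pk) => m Pm m_max; exists m; first exact: Pk.
case/asboolP: Pm => b [Vb b_free]; exists b; split=> //.
apply/seteqP; split=> [f Vf|_ [a ->]]; last exact: Vsum.
apply: contrapT => f_span.
suff /m_max : P m.+1 by rewrite ltnn.
(* The enlarged family has f at index 0, followed by [b]. *)
apply/asboolP; exists (fun i => oapp b f (unlift ord0 i)); split=> [i|a].
  by case: unlift => [j|] /=.
rewrite big_ord_recl unlift_none /=; under eq_bigr do rewrite liftK.
move=> a0; have a00 : a ord0 = 0.
  (* With a nonzero coefficient on f, the relation could be solved for f, placing it in the span of
     [b]. *)
  apply: contrapT => /eqP an0; apply: f_span.
  exists (fun i => - (a ord0)^-1 * a (lift ord0 i)).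
  under eq_bigr do rewrite -scalerA; rewrite -scaler_sumr.
  rewrite (_ : \sum_i _ = - (a ord0 *: f)); last first.
    by apply/eqP; rewrite -addr_eq0 addrC a0.
  by rewrite scalerN scaleNr opprK scalerA mulVf // scale1r.
move: a0; rewrite a00 scale0r add0r => /b_free a1 i.
by case: (unliftP ord0 i) => [j ->|->] //; apply: (a1 j).
Qed.

(** Injectivity is asked on V only, so that a substitution invertible merely on a solution space can
    be used. *)
Lemma subspace_dim_le (R : realType) (E F : lmodType K)
    (phi : {linear E -> F}) (V : set E) (W : set F) :
  V 0 -> (forall a x y, V x -> V y -> V (a *: x + y)) ->
  (forall x, V x -> phi x = 0 -> x = 0) -> (forall x, V x -> W (phi x)) ->
  (subspace_dim R V <= subspace_dim R W)%E.
Proof.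
move=> V0 VL phi_inj phiW; rewrite /subspace_dim.
case: (pselect (exists k, has_basis W k)) => [Wfin|_]; last exact: leey.
case: (cid Wfin) => k Wk /=.
have [m _ Vm] := sub_has_basis E F phi V W k V0 VL phi_inj phiW Wk.
case: pselect => [Vfin|[]]; last by exists m.
(* The chosen size [l] is bounded directly, without comparing it with the size of the basis found
   above. *)
case: (cid Vfin) => l [b [b_free Vb]] /=; rewrite lee_fin ler_nat.
apply: (free_family_bound E F phi V W k l b) => // a.
by rewrite Vb; exists a.
Qed.

End Dimension.

(** * Integer kernels and rational splittings *)

Lemma clear_denominators n (u : 'cV[rat]_n) :
  exists (a : int) (z : 'cV[int]_n), a != 0 /\ ratmx z = a%:~R *: u.
Proof.
pose a := \prod_i denq (u i 0).
exists a, (\col_i (numq (u i 0) * \prod_(j | j != i) denq (u j 0))).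
split; first by apply/prodf_neq0 => i _; apply: denq_neq0.
apply/colP => i; rewrite !mxE /a [in RHS](bigD1 i) //= !intrM.
by rewrite numqE mulrC mulrCA [RHS]mulrC; congr (_ * _); exact: mulrC.
Qed.

(** After clearing denominators, a rational kernel vector of A lies in L, hence in the column span
    of B, which B D^T fixes. So 1 - B D^T kills the kernel of A and factors through A. *)
Lemma integer_kernel_splitting d n h (A : 'M[int]_(d, n)) (B : 'M[int]_(n, h)) :
  row_free (ratmx B)^T ->
  (forall u, kerL A u -> exists c, u = B *m c) ->
  exists (D : 'M[rat]_(n, h)) (E : 'M[rat]_(n, d)),
    (ratmx B)^T *m D = 1%:M /\ ratmx B *m D^T = 1%:M - E *m ratmx A.
Proof.
move=> /row_freeP [D BD] kerB; exists D.
(* The columns of [cokermx (ratmx A)] are rational kernel vectors of A, and multiplying this matrix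
   on the left tests membership in the row space of A. *)
have [X BX] : exists X, cokermx (ratmx A) = ratmx B *m X.
  have /choice [x xP] j : exists x, col j (cokermx (ratmx A)) = ratmx B *m x.
    have [a [z [a0 za]]] := clear_denominators _ (col j (cokermx (ratmx A))).
    have /kerB [c zc] : kerL A z.
      suff : ratmx (A *m z) = ratmx 0.
        move=> /matrixP zE; apply/matrixP => i k.
        by apply: (@intr_inj rat); have := zE i k; rewrite !mxE.
      rewrite /ratmx map_mxM map_mx0 -/(ratmx A) -/(ratmx z) za -scalemxAr.
      by rewrite colE mulmxA mulmx_coker mul0mx scaler0.
    exists (a%:~R^-1 *: ratmx c); rewrite -scalemxAr -map_mxM -zc -/(ratmx z) za.
    by rewrite scalerA mulVf ?scale1r // intr_eq0.
  exists (\matrix_(i, j) x j i 0); apply/matrixP => i j.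
  have /colP/(_ i) := xP j; rewrite !mxE => ->.
  by apply: eq_bigr => k _; rewrite mxE.
have /submxP [E EP] : (1%:M - ratmx B *m D^T <= ratmx A)%MS.
  rewrite submxE BX mulmxBl mul1mx mulmxA -[_ *m ratmx B]mulmxA.
  by rewrite -[D^T *m _]trmxK trmx_mul trmxK BD trmx1 mulmx1 subrr.
by exists E; rewrite -EP subKr.
Qed.

(** * Transport of the orthogonal spaces along [Psi] *)

Section Main.
Context {R : realType}.
Local Notation C := R[i].

Lemma PsiE n h (B : 'M[int]_(n, h)) (q : {mpoly C[h]}) :
  Psi B q = lin_subst (cplxmx R B) q.
Proof.
congr (comp_mpoly _ q).
apply: eq_from_tnth => k; rewrite !tnth_mktuple.
by apply: eq_bigr => j _; rewrite mxE.
Qed.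

Lemma BsE n h (B : 'M[int]_(n, h)) j :
  Bs B j = lin_subst (cplxmx R B)^T 'X_j.
Proof. by rewrite lin_substX; apply: eq_bigr => k _; rewrite !mxE. Qed.

(** Independence of the columns gives a rational left inverse of B, and substituting it undoes
    [Psi B]. *)
Lemma Psi_inj n h (B : 'M[int]_(n, h)) :
  row_free (ratmx B)^T -> injective (Psi B : {mpoly C[h]} -> _).
Proof.
move=> /row_freeP [D BD].
apply: (can_inj (g := lin_subst (map_mx ratr D^T))) => q.
rewrite PsiE lin_subst_mul -[RHS]lin_subst1; congr (lin_subst _ q).
have -> : cplxmx R B = map_mx ratr (ratmx B).
  by apply/matrixP => i j; rewrite !mxE ratr_int.
by rewrite -map_mxM -[ratmx B]trmxK -trmx_mul BD trmx1 map_mx1.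
Qed.

Lemma perp_Psi d n h M (A : 'M[int]_(d, n)) (B : 'M[int]_(n, h)) v
    (g : 'I_M -> 'cV[int]_n) (q : {mpoly C[h]}) :
  (forall k, kerL A (col k B)) -> row_free (ratmx B)^T ->
  perp (P_ideal B v g) q <-> Q_perp A v g (Psi B q).
Proof.
move=> AB B_free; rewrite perp_ideal_genE Q_perpE.
have Psi0 phi : diffop phi (Psi B q) = 0 <->
    diffop (lin_subst (cplxmx R B)^T phi) q = 0.
  rewrite PsiE diffop_lin_subst -PsiE; split=> [|->]; last by rewrite PsiE raddf0.
  by move=> P0; apply: (Psi_inj _ _ _ B_free); rewrite P0 PsiE raddf0.
have prodE i : lin_subst (cplxmx R B)^T (\prod_(j in Gset v (g i)) 'X_j)
    = \prod_(j in Gset v (g i)) Bs B j.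
  by rewrite rmorph_prod; apply: eq_bigr => j _; rewrite BsE.
split=> [Pq|[_ Gq] _ [i _ <-]]; last first.
  by rewrite -prodE; apply/Psi0.
split=> [k|i]; apply/Psi0; last by rewrite prodE; apply: Pq; exists i.
(* Under theta |-> B s the form of row k of A gets the entries of row k of A B as coefficients, and
   A B = 0. *)
rewrite raddf_sum (_ : \sum_j _ = 0) ?diffop0 //=.
under eq_bigr do rewrite linearZ /= lin_substX scaler_sumr.
rewrite exchange_big big1 // => l _.
under eq_bigr do rewrite !mxE scalerA.
rewrite -scaler_suml; have /matrixP/(_ k 0) := AB l; rewrite !mxE => ABkl.
under eq_bigr do rewrite -intrM.
rewrite -rmorph_sum /= (_ : \sum_j _ = 0) ?scale0r // -[RHS]ABkl.
by apply: eq_bigr => j _; rewrite mxE.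
Qed.

(** A single substitution inverts [Psi B] for all f at once, so it serves both for surjectivity and
    as the linear map in the reverse dimension bound. *)
Lemma Psi_section d n h M (A : 'M[int]_(d, n)) (B : 'M[int]_(n, h)) v
    (g : 'I_M -> 'cV[int]_n) :
  row_free (ratmx B)^T ->
  (forall u, kerL A u -> exists c, u = B *m c) ->
  exists D : 'M[C]_(h, n), forall f, Q_perp A v g f -> Psi B (lin_subst D f) = f.
Proof.
move=> B_free kerB.
have [D [E [_ DE]]] := integer_kernel_splitting _ _ _ A B B_free kerB.
exists (map_mx ratr D^T) => f /Q_perpE [Af _].
rewrite PsiE lin_subst_mul.
apply: (lin_subst_invariant _ _ (cplxmx R A) (map_mx ratr E)) => [|k]; last first.
  by rewrite -[RHS](Af k); congr (diffop _ f); apply: eq_bigr => j _; rewrite mxE.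
have ratrE m p (N : 'M[int]_(m, p)) : cplxmx R N = map_mx ratr (ratmx N).
  by apply/matrixP => i j; rewrite !mxE ratr_int.
by rewrite !ratrE -!map_mxM DE map_mxB map_mx1.
Qed.

End Main.

Theorem theorem3p14 (R : realType) (d n : nat) (A : 'M[int]_(d, n))
  (rankA : \rank (ratmx A) = d) (homA : homogeneous_mx A)
  (beta : 'cV[R[i]]_d) (w : 'cV[R]_n)
  (w_generic : monomial_ideal (init_ideal w (toric_ideal A)))
  (v : 'cV[R[i]]_n) (v_fake : fake_exponent A beta w v)
  (h : nat) (B : 'M[int]_(n, h))
  (B_sub : forall k, kerL A (col k B))
  (B_free : row_free (ratmx B)^T)
  (B_supp : forall u : 'cV[int]_n, kerL A u ->
     nsupp v \subset supp_rows B :|: nsupp (v + cplxmx R u))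
  (M : nat) (g : 'I_M -> 'cV[int]_n)
  (g_gb : reduced_groebner_basis w (toric_ideal A)
     [set 'X_[pos_part (g i)] - 'X_[neg_part (g i)] | i in [set: 'I_M]])
  (g_init : forall i,
     init_ideal w (toric_ideal A) 'X_[pos_part (g i)]) :
  [/\ perp (P_ideal B v g) = Psi B @^-1` Q_perp A v g,
      (subspace_dim R (perp (P_ideal B v g)) <= subspace_dim R (Q_perp A v g))%E &
      (forall u : 'cV[int]_n,
         kerL A u -> exists c : 'cV[int]_h, u = B *m c) ->
      Psi B @` perp (P_ideal B v g) = Q_perp A v g /\
      subspace_dim R (Q_perp A v g) = subspace_dim R (perp (P_ideal B v g))].
Proof.
have perpE q : perp (P_ideal B v g) q <-> Q_perp A v g (Psi B q).
  exact: perp_Psi.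
have Psi_ker q : Psi B q = 0 -> q = 0.
  by move=> q0; apply: (Psi_inj _ _ _ B_free); rewrite q0 PsiE raddf0.
have perp_lin : perp (P_ideal B v g) 0 /\ forall a x y,
    perp (P_ideal B v g) x -> perp (P_ideal B v g) y ->
    perp (P_ideal B v g) (a *: x + y).
  split=> [|a x y /perp_ideal_genE Px /perp_ideal_genE Py];
    apply/perp_ideal_genE => p Pp; first exact: raddf0.
  by rewrite linearP /= Px // Py // scaler0 addr0.
have Q_lin : Q_perp A v g 0 /\ forall a x y,
    Q_perp A v g x -> Q_perp A v g y -> Q_perp A v g (a *: x + y).
  split=> [p _|a x y Qx Qy p Qp]; first exact: raddf0.
  by rewrite linearP /= Qx // Qy // scaler0 addr0.
have dim_le : (subspace_dim R (perp (P_ideal B v g)) <=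
    subspace_dim R (Q_perp A v g))%E.
  case: perp_lin => P0 PL.
  (* [lin_subst] stands in for [Psi B] because it carries the linear structure. *)
  apply: (subspace_dim_le R _ _ (lin_subst (cplxmx R B))) => // x.
    by move=> _ /=; rewrite -PsiE; exact: Psi_ker.
  by move=> /perpE; rewrite PsiE.
split=> //.
  by apply/seteqP; split=> q /perpE.
move=> kerB.
have [D PsiD] := Psi_section _ _ _ _ A B v g B_free kerB.
split.
  apply/seteqP; split=> [_ [q /perpE Qq <-] //|f Qf].
  exists (lin_subst D f); last exact: PsiD.
  by apply/perpE; rewrite PsiD.
apply/eqP; rewrite eq_le dim_le andbT; case: Q_lin => Q0 QL.
(* On [Q_perp] the map [lin_subst D] is injective, since [Psi B] recovers f from its image. *)
apply: (subspace_dim_le R _ _ (lin_subst D)) => // f Qf.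
  by move=> Df; rewrite -(PsiD f Qf) Df PsiE raddf0.
by apply/perpE; rewrite PsiD.
Qed.
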